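(* Let $G$ be a finite set of ground terms over $\Omega$ which is closed under subterms, and let $S\subseteq\mathcal{T}_\Omega$ be a set of ground terms closed under subterms with $G\subseteq S$. Then every ground term $t\in\mathcal{T}_\Omega\setminus S$ can be uniquely factored as $t=mx$ such that (A) $m\in M_G$ and $x\notin S$, and (B) $x$ is minimal with property (A).
   Context: $\Omega$ is a ranked signature with non-empty set of constants, $\mathcal{T}_\Omega$ the set of ground terms. $\bullet$ is a fresh variable; a template is a term over $\Omega\cup\{\bullet\}$ containing at least one occurrence of $\bullet$; for a template $m$ and a term $x$, $mx$ denotes $m[x/\bullet]$. Templates with this substitution form a monoid with neutral element $\bullet$. $M_G$ denotes the sub-monoid of all templates whose ground subterms (subterms not containing $\bullet$) are all contained in $G$. Minimality in (B) refers to the subterm ordering on ground terms. *)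

(* Defs.v *)
From mathcomp Require Import all_boot.
From mathcomp Require Import boolp classical_sets functions cardinality.

Set Implicit Arguments.
Unset Strict Implicit.
Unset Printing Implicit Defensive.

Local Open Scope classical_set_scope.

Record signature := Signature {
  symbol :> Type;
  arity : symbol -> nat }.

Unset Elimination Schemes.
Inductive term (Omega : signature) (X : Type) : Type :=
| Var of X
| App (f : Omega) of {ffun 'I_(arity f) -> term Omega X}.
Set Elimination Schemes.

Arguments Var {Omega X}.
Arguments App {Omega X} f.

(* The scheme Rocq would generate gives no hypothesis on the arguments of f. *)
Lemma term_ind (Omega : signature) (X : Type) (P : term Omega X -> Prop) :
  (forall v, P (Var v)) ->
  (forall f (a : {ffun 'I_(arity f) -> term Omega X}),
     (forall i, P (a i)) -> P (App f a)) ->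
  forall t, P t.
Proof.
by move=> hV hA; fix IH 1 => -[v|f a]; [exact: hV | apply: hA => i; exact: IH].
Qed.

Fixpoint subst (Omega : signature) (X Y : Type) (s : X -> term Omega Y)
    (t : term Omega X) : term Omega Y :=
  match t with
  | Var v => s v
  | App f a => App f [ffun i => subst s (a i)]
  end.

Inductive subterm (Omega : signature) (X : Type) (u : term Omega X) :
    term Omega X -> Prop :=
| subterm_refl : subterm u u
| subterm_arg (f : Omega) (a : {ffun 'I_(arity f) -> term Omega X})
    (i : 'I_(arity f)) : subterm u (a i) -> subterm u (App f a).

Definition subterm_closed (Omega : signature) (X : Type)
    (A : set (term Omega X)) : Prop :=
  forall t u, A t -> subterm u t -> A u.

Definition ground (Omega : signature) : Type := term Omega void.

(* The variable type unit has exactly one element: the fresh variable. *)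
Definition bullet {Omega : signature} : term Omega unit := Var tt.

Definition inject (Omega : signature) : ground Omega -> term Omega unit :=
  subst (of_void _).

Definition template (Omega : signature) : set (term Omega unit) :=
  [set m | subterm bullet m].

(* m[x / bullet], where every occurrence of the variable is replaced. *)
Definition plug (Omega : signature) (m : term Omega unit) (x : ground Omega) :
    ground Omega :=
  subst (fun=> x) m.

Definition templates_over (Omega : signature) (G : set (ground Omega)) :
    set (term Omega unit) :=
  [set m | template m /\
     forall u, subterm u m -> ~ subterm bullet u -> (@inject Omega @` G) u].

Definition admissible (Omega : signature) (G S : set (ground Omega))
    (m : term Omega unit) (x : ground Omega) : Prop :=
  templates_over G m /\ ~ S x.

(* Minimality in the subterm order, among the right factors x' of all
   admissible factorizations t = m' x', with m' varying too. *)
Definition minimal_factor (Omega : signature) (G S : set (ground Omega))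
    (t x : ground Omega) : Prop :=
  forall m' x', t = plug m' x' -> admissible G S m' x' ->
    subterm x' x -> x' = x.

(* Main.v *)
(* The key point is a dichotomy at each argument of t: in a factorization
   f(b_1, ..., b_n) x of f(a_1, ..., a_n), either b_i is ground, and then a_i
   lies in G, or b_i is a template, and then a_i contains x and so lies outside
   S, hence outside G.  Which case occurs is thus read off a_i alone.  Hence x
   determines m, and the right factors of t form a chain for the subterm order:
   two of them are also right factors of a common proper subterm of t, unless
   one of them is t itself. *)
Require Import Defs.
From mathcomp Require Import all_boot.
From mathcomp Require Import boolp classical_sets functions cardinality.

Set Implicit Arguments.
Unset Strict Implicit.
Unset Printing Implicit Defensive.

Local Open Scope classical_set_scope.

(** Constructor injectivity only equates dependent pairs over [f]. Proof irrelevance makes the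
    transport along [f = f] trivial, with no decidable equality on symbols. *)
Lemma App_inj (Omega : signature) (X : Type) (f : Omega)
    (a b : {ffun 'I_(arity f) -> term Omega X}) :
  App f a = App f b -> a = b.
Proof.
case=> e; have := projT2_eq e.
by rewrite (Prop_irrelevance (projT1_eq e) erefl).
Qed.

Lemma subtermE (Omega : signature) (X : Type) (u t : term Omega X) :
  subterm u t ->
  u = t \/ if t is App f a then exists i, subterm u (a i) else False.
Proof. by case=> [|f a i ui]; [left | right; exists i]. Qed.

Lemma subterm_trans (Omega : signature) (X : Type) (u v w : term Omega X) :
  subterm u v -> subterm v w -> subterm u w.
Proof.
by move=> uv vw; elim: vw => // f a i _; exact: subterm_arg.
Qed.

Lemma subterm_acyclic (Omega : signature) (X : Type) (f : Omega)
    (a : {ffun 'I_(arity f) -> term Omega X}) (i : 'I_(arity f)) :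
  ~ subterm (App f a) (a i).
Proof.
suff H (t : term Omega X) :
    if t is App g b return Prop then forall j, ~ subterm t (b j) else True.
  exact: (H (App f a) i).
elim/term_ind: t => [//|g b IH] j tj.
(* If [t] equals [b j], then [b j] lies below its own argument. If [t] lies below an argument [c k]
   of [b j], then so does [b j], an argument of [t]. Both contradict the induction hypothesis at
   [j]. *)
case: (subtermE tj) => [bE|].
  by have := IH j; rewrite -bE => /(_ j); apply.
have := IH j; case bjE: (b j) => [//|h c] cP [k tk].
apply: (cP k); apply: subterm_trans tk; rewrite -bjE.
exact: subterm_arg (subterm_refl _).
Qed.

Lemma plug_inject (Omega : signature) (g x : ground Omega) :
  plug (inject g) x = g.
Proof.
elim/term_ind: g => [[]|f a IH] /=; congr (App f _).
by apply/ffunP => i; rewrite !ffunE; exact: IH.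
Qed.

Lemma subterm_plug (Omega : signature) (m : term Omega unit)
    (x : ground Omega) :
  template m -> subterm x (plug m x).
Proof.
rewrite /template /=; elim=> [|f a i _ IH]; first exact: subterm_refl.
by rewrite /plug /=; apply: (@subterm_arg _ _ _ _ _ i); rewrite ffunE.
Qed.

Lemma templates_over_arg (Omega : signature) (G : set (ground Omega))
    (f : Omega) (b : {ffun 'I_(arity f) -> term Omega unit})
    (i : 'I_(arity f)) :
  templates_over G (App f b) ->
  templates_over G (b i) \/ exists2 g, G g & b i = inject g.
Proof.
case=> _ bG; have [bi|bi] := pselect (template (b i)).
  by left; split=> // u ui; apply: bG; exact: subterm_arg ui.
have [|g Gg <-] := bG (b i) _ bi; last by right; exists g.
exact: subterm_arg (subterm_refl _).
Qed.

Lemma template_arg (Omega : signature) (f : Omega)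
    (b : {ffun 'I_(arity f) -> term Omega unit}) :
  template (App f b) -> exists i, template (b i).
Proof. by move=> /subtermE[]. Qed.

Section Factorization.
Variables (Omega : signature) (G S : set (ground Omega)).
Hypotheses (closedS : subterm_closed S) (GS : G `<=` S).

Lemma plug_notin (m : term Omega unit) (x : ground Omega) :
  template m -> ~ S x -> ~ S (plug m x).
Proof. by move=> mt xS /closedS /(_ (subterm_plug x mt)). Qed.

Lemma App_plug_arg (f : Omega)
    (b b' : {ffun 'I_(arity f) -> term Omega unit}) (x x' : ground Omega) :
  plug (App f b) x = plug (App f b') x' ->
  forall i, plug (b i) x = plug (b' i) x'.
Proof. by move=> /App_inj /ffunP + i => /(_ i); rewrite !ffunE. Qed.

(** A ground [b i] comes from [G] and is unchanged by plugging, so its value would lie in [S]. *)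
Lemma templates_over_arg_plug (f : Omega)
    (b : {ffun 'I_(arity f) -> term Omega unit}) (x : ground Omega)
    (i : 'I_(arity f)) :
  templates_over G (App f b) -> ~ S (plug (b i) x) -> templates_over G (b i).
Proof.
move=> /(templates_over_arg i)[//|[g Gg ->]].
by rewrite plug_inject => /(_ (GS Gg)).
Qed.

Lemma right_factors_chain (m m' : term Omega unit) (x x' : ground Omega) :
  admissible G S m x -> admissible G S m' x' -> plug m x = plug m' x' ->
  subterm x x' \/ subterm x' x.
Proof.
elim/term_ind: m m' => [[]|f b IH] m' [mG xS] [m'G x'S].
  by move=> e; right; rewrite (e : x = _); exact: subterm_plug m'G.1.
case: m' m'G => [[] _ e|f' b' m'G e].
  by left; rewrite -(e : _ = x'); exact: subterm_plug mG.1.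
have ff' : f = f' by case: e.
case: f' / ff' b' m'G e => b' m'G /App_plug_arg e.
(* One argument holding [bullet] suffices: its value lies outside [S], which forces [b' i] to be a
   template as well. *)
have [i bi] := template_arg mG.1.
have biS := plug_notin bi xS.
apply: (IH i (b' i)) (e i); split=> //.
  exact: templates_over_arg_plug biS.
by apply: (templates_over_arg_plug (x := x')) m'G _; rewrite -e.
Qed.

(** Otherwise [x], which occurs inside some argument of [plug (App f b) x], would be a proper
    subterm of itself. *)
Lemma plug_App_neq (f : Omega) (b : {ffun 'I_(arity f) -> term Omega unit})
    (x : ground Omega) :
  template (App f b) -> plug (App f b) x <> x.
Proof.
move=> /template_arg[i bi] e.
have := subterm_plug x bi; rewrite -{1}e /plug /= => h.
apply: (@subterm_acyclic _ _ f [ffun i => subst (fun=> x) (b i)] i).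
by rewrite ffunE.
Qed.

Lemma left_factor_unique (m m' : term Omega unit) (x : ground Omega) :
  admissible G S m x -> admissible G S m' x -> plug m x = plug m' x ->
  m = m'.
Proof.
elim/term_ind: m m' => [[]|f b IH] [[]|f' b'] [mG xS] [m'G _] //.
- by move=> /esym /(plug_App_neq m'G.1).
- by move=> /(plug_App_neq mG.1).
move=> e; have ff' : f = f' by case: e.
case: f' / ff' b' m'G e => b' m'G /App_plug_arg e.
congr (App f _); apply/ffunP => i.
(* A value in [S] makes both arguments ground, hence equal to that value; a value outside [S] makes
   both templates, and induction applies. *)
have [biS|biS] := pselect (S (plug (b i) x)).
  have [[bi _]|[g _ bE]] := templates_over_arg i mG.
    by case: (plug_notin bi xS).
  have [[b'i _]|[g' _ b'E]] := templates_over_arg i m'G.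
    by case: (plug_notin b'i xS); rewrite -e.
  by have := e i; rewrite bE b'E !plug_inject => ->.
apply: (IH i) (e i); split=> //; first exact: templates_over_arg_plug biS.
by apply: (templates_over_arg_plug (x := x)) m'G _; rewrite -e.
Qed.

End Factorization.

Lemma exists_subterm_minimal (Omega : signature) (X : Type)
    (P : set (term Omega X)) (t : term Omega X) :
  P t -> exists2 x, P x & forall y, P y -> subterm y x -> y = x.
Proof.
(* Allowing the witness anywhere below [u] lets the induction descend into an argument of [u]. *)
suff H u y : subterm y u -> P y ->
    exists2 x, P x & forall z, P z -> subterm z x -> z = x.
  exact: (H t t (subterm_refl t)).
elim/term_ind: u y => [v|f a IH] y.
  move=> /subtermE[->|//] Pv; exists (Var v) => // z _.
  by move=> /subtermE[].
move=> /subtermE[->|[i yi]] Py; last exact: IH yi Py.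
have [[i [z zi Pz]]|noz] :=
    pselect (exists i, exists2 z, subterm z (a i) & P z).
  exact: IH zi Pz.
exists (App f a) => // z Pz /subtermE[//|[i zi]].
by case: noz; exists i, z.
Qed.

Theorem theorem3 (Omega : signature)
    (hconst : exists c : Omega, arity c = 0%N)
    (G S : set (ground Omega))
    (finG : finite_set G) (closedG : subterm_closed G)
    (closedS : subterm_closed S) (GS : G `<=` S)
    (t : ground Omega) (tS : ~ S t) :
  exists! mx : term Omega unit * ground Omega,
    [/\ t = plug mx.1 mx.2,
        admissible G S mx.1 mx.2
      & minimal_factor G S t mx.2].
Proof.
have [|x [m tE mx] xmin] := @exists_subterm_minimal Omega void
    [set x | exists2 m, t = plug m x & admissible G S m x] t.
  (* [t] is a right factor of itself: [bullet] has no ground subterms. *)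
  exists bullet => //; split=> //; split; first exact: subterm_refl.
  by move=> u /subtermE[-> []|//]; exact: subterm_refl.
have xmin' : minimal_factor G S t x.
  by move=> m' x' tE' mx' ?; apply: xmin => //; exists m'.
exists (m, x); split=> // -[m' x'] [/= tE' mx' x'min].
have e : plug m x = plug m' x' by rewrite -tE.
(* The two factors are comparable, and the minimality of the larger one identifies them. *)
have xx' : x = x'.
  case: (right_factors_chain closedS GS mx mx' e) => [|x'x].
    exact: x'min tE mx.
  by symmetry; exact: xmin' tE' mx' x'x.
move: mx' e; rewrite -xx' => mx' e.
by rewrite (left_factor_unique closedS GS mx mx' e).
Qed.
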